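(* Let $(\mathcal V,p,e)$ be a hyperbolic system of degree $n>1$, and let $D=[d_{ij}]$ be a real $n\times n$ matrix. (1) If $D$ is doubly stochastic, then for every $e$-doubly stochastic $\mathcal V$-matrix $\mathbf A$, the $\mathcal V$-matrix $D\mathbf A$ is $e$-doubly stochastic. (2) The converse holds when $\dim(\mathcal V)>1$ and $D$ is a nonnegative matrix: in that case, if $D\mathbf A$ is $e$-doubly stochastic for every $e$-doubly stochastic $\mathcal V$-matrix $\mathbf A$, then $D$ is doubly stochastic. (3) In particular, the converse holds when $\mathcal V$ has a Jordan frame: in that case, if $D$ is any real $n\times n$ matrix such that $D\mathbf A$ is $e$-doubly stochastic for every $e$-doubly stochastic $\mathcal V$-matrix $\mathbf A$, then $D$ is doubly stochastic.
   Context: A hyperbolic system $(\mathcal V,p,e)$ of degree $n$ consists of a nonzero finite-dimensional real vector space $\mathcal V$, a nonzero element $e\in\mathcal V$, and a real homogeneous polynomial $p$ of degree $n$ on $\mathcal V$ such that $p(e)\neq 0$ and, for each $x\in\mathcal V$, the univariate polynomial $t\mapsto p(te-x)$ has only real zeros. For $x\in\mathcal V$, $\lambda(x)=(\lambda_1(x),\dots,\lambda_n(x))^T\in\mathbb R^n$ is the vector of these zeros (with multiplicity) in decreasing order. The hyperbolicity cone is $\Lambda_+=\{x\in\mathcal V:\lambda(x)\ge 0\}$. The trace is $\operatorname{tr}(x)=\sum_{i=1}^n\lambda_i(x)$. (No completeness of $p$ is assumed.) A $\mathcal V$-matrix is an $n$-tuple $\mathbf A=[a_1,\dots,a_n]$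 of elements of $\mathcal V$. It is $e$-doubly stochastic if $a_i\in\Lambda_+$ and $\operatorname{tr}(a_i)=1$ for all $i$, and $a_1+\dots+a_n=e$. For a real $n\times n$ matrix $D=[d_{ij}]$, $D\mathbf A=[b_1,\dots,b_n]$ with $b_i=\sum_{j=1}^n d_{ij}a_j$. A real $n\times n$ matrix is doubly stochastic if its entries are nonnegative and every row and every column sums to $1$. A set $\{c_1,\dots,c_n\}\subset\mathcal V$ is a Jordan frame if $\lambda(c_i)=(1,0,\dots,0)^T$ for all $i$ and $c_1+\dots+c_n=e$. *)

(* Defs.v *)
From HB Require Import structures.
From mathcomp Require Import all_boot all_order all_algebra.
From mathcomp Require Import reals.
From mathcomp Require Import complex polyrcf.
From mathcomp Require Import mpoly.

Set Implicit Arguments.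
Unset Strict Implicit.
Unset Printing Implicit Defensive.

Import Order.TTheory GRing.Theory Num.Theory.
Local Open Scope ring_scope.

Section Polynomial.
Variables (R : realType) (V : vectType R).
Implicit Types (p : {mpoly R[\dim {:V}]}) (e x : V).

(* A polynomial on V is a polynomial in the coordinates with respect to the
   canonical basis of V; none of the notions below depends on this basis. *)
Definition evalV p x : R := p.@[fun i => coord (vbasis {:V}) i x].

(* t |-> p (t e - x), as a univariate polynomial; see horner_charpolyV. *)
Definition charpolyV p e x : {poly R} :=
  mmap (@polyC R)
    (fun i => coord (vbasis {:V}) i e *: 'X - (coord (vbasis {:V}) i x)%:P) p.

Lemma horner_charpolyV p e x t :
  (charpolyV p e x).[t] = evalV p (t *: e - x).
Proof.
rewrite /charpolyV /evalV mevalE /mmap horner_sum.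
apply: eq_bigr => m _; rewrite hornerM hornerC /mmap1 horner_prod.
congr (_ * _); apply: eq_bigr => i _.
rewrite horner_exp hornerD hornerN hornerZ hornerX hornerC.
by rewrite linearB linearZ /= mulrC.
Qed.

Definition real_rooted (q : {poly R}) : Prop :=
  forall z : R[i], root (map_poly (real_complex R) q) z -> complex.Im z = 0.

Definition deg_le_coef (q : {poly R}) (d : nat) (c : R) : Prop :=
  (size q <= d.+1)%N /\ q`_d = c.

Lemma deg_le_coefM q1 q2 d1 d2 c1 c2 :
  deg_le_coef q1 d1 c1 -> deg_le_coef q2 d2 c2 ->
  deg_le_coef (q1 * q2) (d1 + d2) (c1 * c2).
Proof.
move=> [s1 <-] [s2 <-]; split.
  apply: leq_trans (size_polyMleq _ _) _.
  rewrite -subn1 leq_subLR add1n.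
  by apply: leq_trans (leq_add s1 s2) _; rewrite addSn addnS.
rewrite coefM.
have lt1 : (d1 < (d1 + d2).+1)%N by rewrite ltnS leq_addr.
rewrite (bigD1 (Ordinal lt1)) //= addKn big1 ?addr0 // => i /eqP ne.
case: (ltngtP i d1) => [lt|gt|eq].
- rewrite [q2`__]nth_default ?mulr0 //.
  by apply: leq_trans s2 _; rewrite ltn_subRL ltn_add2r.
- by rewrite [q1`__]nth_default ?mul0r //; apply: leq_trans s1 _.
- by case: ne; apply: val_inj.
Qed.

Lemma coef_charpolyV n p e x :
  p \is n.-homog -> deg_le_coef (charpolyV p e x) n (evalV p e).
Proof.
move=> hp.
have h m : m \in msupp p -> deg_le_coef
    ((p@_m)%:P * mmap1 (fun i => coord (vbasis {:V}) i e *: 'X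
       - (coord (vbasis {:V}) i x)%:P) m) n
    (p@_m * \prod_i coord (vbasis {:V}) i e ^+ m i).
  move=> m_p; rewrite -[n]add0n; apply: deg_le_coefM.
    by split; rewrite ?coefC // size_polyC leq_b1.
  have /= <- := dhomog_mf hp m_p.
  rewrite /mmap1 /= mdegE.
  apply: (big_rec3 (fun q d c => deg_le_coef q d c)).
    by split; rewrite ?coefC // size_poly1.
  move=> i q d c _; apply: deg_le_coefM.
  elim: (m i) => [|k IH]; first by split; rewrite ?coefC // size_poly1.
  rewrite !exprS -add1n; apply: deg_le_coefM => //; split.
    rewrite (leq_trans (size_polyD _ _)) // geq_max size_polyN.
    rewrite (leq_trans (size_scale_leq _ _)) ?size_polyX //=.
    by rewrite size_polyC (leq_trans (leq_b1 _)).
  by rewrite coefB coefZ coefX coefC mulr1 subr0.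
rewrite /charpolyV /evalV mevalE /mmap; split.
  apply: leq_trans (size_sum _ _ _) _.
  by apply/bigmax_leqP_seq => m m_p _; case: (h m m_p).
rewrite coef_sum big_seq [RHS]big_seq.
by apply: eq_bigr => m m_p; case: (h m m_p).
Qed.

(* The real zeros of q, with multiplicity, in decreasing order. *)
Definition roots_mult (q : {poly R}) : seq R :=
  flatten [seq nseq (mup a q) a | a <- rev (rootsR q)].

Lemma sorted_roots_mult q : sorted >=%R (roots_mult q).
Proof.
have: sorted >%R (rev (rootsR q)).
  by rewrite rev_sorted; apply: sorted_roots.
rewrite /roots_mult; elim: (rev _) => //= a s IH.
rewrite path_sortedE; last by move=> x y z /= h1 h2; exact: lt_trans h2 h1.
case/andP=> /allP ha hs.
rewrite sorted_pairwise; last by move=> x y z /= h1 h2; exact: le_trans h2 h1.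
rewrite pairwise_cat -!sorted_pairwise;
  try by move=> x y z /= h1 h2; exact: le_trans h2 h1.
rewrite IH // andbT; apply/andP; split.
  apply/allrelP => x y /nseqP [-> _] /flatten_mapP [b bs /nseqP [-> _]].
  exact: ltW (ha _ bs).
case: (mup a q) => //= k; elim: k => //= k ->.
by rewrite lexx.
Qed.

Lemma roots_multP q : q != 0 -> real_rooted q ->
  q = lead_coef q *: \prod_(a <- roots_mult q) ('X - a%:P).
Proof.
move=> q0 qR; set P := \prod_(_ <- _) _.
have PE : P = \prod_(a <- rootsR q) ('X - a%:P) ^+ mup a q.
  rewrite /P /roots_mult big_flatten big_map /=.
  rewrite (perm_big (rootsR q)) /=; last by rewrite perm_rev.
  by apply: eq_bigr => a _; rewrite big_nseq iter_mulr_1.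
have Pmonic : P \is monic.
  by apply: monic_prod => a _; exact: monicXsubC.
have P_dvd : P %| q.
  rewrite PE.
  have : uniq (rootsR q) by exact: uniq_roots.
  elim: (rootsR q) => [|a s IH] /=; first by rewrite big_nil dvd1p.
  case/andP=> a_s /IH s_q; rewrite big_cons Gauss_dvdp ?s_q ?andbT -?mup_geq //.
  rewrite coprimep_expl // big_seq.
  elim/big_ind: _ => [|x y hx hy|b b_s]; first exact: coprimep1.
    by rewrite coprimepMr hx.
  rewrite coprimep_expr // coprimep_XsubC root_XsubC.
  by apply: contraNneq a_s => <-.
have [r qE] : exists r, q = r * P by case/dvdpP: P_dvd => r; exists r.
have [r0 P0] : r != 0 /\ P != 0 by apply/andP; rewrite -negb_or -mulf_eq0 -qE.
have rN a : ~~ root r a.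
  apply/negP => ra; have qa : root q a by rewrite qE rootM ra.
  have a_in : a \in rootsR q by rewrite -roots_on_rootsR // inE /= qa.
  have : (mup a q <= mup a P)%N.
    rewrite mup_geq // PE (big_rem a) //= dvdp_mulr //.
  rewrite {1}qE mupM // -[leqRHS]add0n leq_add2r leqn0 => /eqP mr.
  by move: ra; rewrite -dvdp_XsubCl XsubC_dvd // mr.
have sr : size r = 1%N.
  apply/eqP; rewrite -(size_map_poly (real_complex R)).
  apply/negPn/negP => /closed_rootP [z rz].
  have Iz : complex.Im z = 0.
    by apply: qR; rewrite qE rmorphM rootM rz.
  move: rz; rewrite (_ : z = real_complex R (complex.Re z)); last first.
    by case: z Iz => x y /= ->.
  by rewrite fmorph_root; apply/negP.
have [c rE] : exists c, r = c%:P by exists r`_0; apply: size1_polyC; rewrite sr.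
rewrite [in LHS]qE rE mul_polyC; congr (_ *: _).
by rewrite qE lead_coef_Mmonic // rE lead_coefC.
Qed.

End Polynomial.

Record hyperbolic_system (R : realType) (V : vectType R) (n : nat) :=
  HyperbolicSystem {
    hpoly : {mpoly R[\dim {:V}]};
    hdir : V;
    hdir_neq0 : hdir != 0;
    hpoly_homog : hpoly \is n.-homog;
    hpoly_dir_neq0 : evalV hpoly hdir != 0;
    hpoly_real_rooted : forall x : V, real_rooted (charpolyV hpoly hdir x)
  }.

Section Hyperbolic.
Variables (R : realType) (V : vectType R) (n : nat).
Variable (S : hyperbolic_system V n).

Definition eigseq (x : V) : seq R :=
  roots_mult (charpolyV (hpoly S) (hdir S) x).

Lemma eigseqP (x : V) : charpolyV (hpoly S) (hdir S) x
  = evalV (hpoly S) (hdir S) *: \prod_(a <- eigseq x) ('X - a%:P).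
Proof.
have [sz co] := coef_charpolyV (hdir S) x (hpoly_homog S).
have nz : charpolyV (hpoly S) (hdir S) x != 0.
  by apply: contraTneq (hpoly_dir_neq0 S) => q0; rewrite -co q0 coef0 eqxx.
rewrite {1}(roots_multP nz (@hpoly_real_rooted _ _ _ S x)) lead_coefE -co.
congr (_`_ _ *: _); apply/eqP; rewrite -eqSS prednK ?size_poly_gt0 //.
rewrite eqn_leq sz ltnNge; apply: contra (hpoly_dir_neq0 S) => le.
by rewrite -co nth_default.
Qed.

Lemma size_eigseq (x : V) : size (eigseq x) = n.
Proof.
have [sz co] := coef_charpolyV (hdir S) x (hpoly_homog S).
have := eigseqP x; have nz := hpoly_dir_neq0 S.
move=> /(congr1 (fun q : {poly R} => size q)).
rewrite size_scale // size_prod_XsubC => szE.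
apply/eqP; rewrite -eqSS -szE eqn_leq sz ltnNge.
by apply: contra nz => le; rewrite -co nth_default.
Qed.

(* [eigseq x] has exactly n entries (size_eigseq), so the default value
   of [nth] is never used. *)
Definition eigval (x : V) : 'cV[R]_n := \col_(i < n) nth 0 (eigseq x) i.

Definition hcone (x : V) : Prop := forall i : 'I_n, 0 <= eigval x i 0.

Definition htrace (x : V) : R := \sum_(i < n) eigval x i 0.

Definition e_doubly_stochastic (A : 'I_n -> V) : Prop :=
  [/\ forall i, hcone (A i),
      forall i, htrace (A i) = 1
    & \sum_(i < n) A i = hdir S].

(* The frame is given as a family; its members are automatically distinct
   when n > 1. *)
Definition jordan_frame (c : 'I_n -> V) : Prop :=
  (forall i, eigval (c i) = \col_(k < n) (val k == 0%N)%:R)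
  /\ \sum_(i < n) c i = hdir S.

End Hyperbolic.

Definition actVmx (R : realType) (V : vectType R) (n : nat)
    (D : 'M[R]_n) (A : 'I_n -> V) : 'I_n -> V :=
  fun i => \sum_(j < n) D i j *: A j.

Definition nonneg_mx (R : realType) (n : nat) (D : 'M[R]_n) : Prop :=
  forall i j, 0 <= D i j.

Definition doubly_stochastic (R : realType) (n : nat) (D : 'M[R]_n) : Prop :=
  [/\ nonneg_mx D,
      forall i, \sum_(j < n) D i j = 1
    & forall j, \sum_(i < n) D i j = 1].

(* Main.v *)
(** The substance is Garding's theorem that the hyperbolicity cone is convex.
    Let [H] be the open upper half plane and let [a], [b] have positive
    eigenvalues.  By hyperbolicity [p (z e + x)] does not vanish for [z] in
    [H] and [x] real.  Fix [z] in [H] and deform [x] to [0]: the zeros [w] of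
    [p (z e + w a + s x)] vary continuously, never become real, and at [s = 0]
    are negative multiples of [z], so they stay in the lower half plane.
    Repeating the argument with the now known nonvanishing on real lines shows
    [p (z e + w a + u b) <> 0] for [z], [w], [u] in [H]; taking all three on
    the positive imaginary axis, homogeneity shows that [a + b] has no negative
    eigenvalue.

    Together with the linearity of the trace this gives (1).  For (2), take a
    traceless [x <> 0] and apply [D] to the matrix all of whose entries are
    [e / n] except for [e / n + d x] and [e / n - d x] at two places, [d] small:
    the column sums at these places agree.  For (3), the entries of [D] are
    shown to be nonnegative by applying [D] to the Jordan frame. *)
Require Import Defs.
From HB Require Import structures.
From mathcomp Require Import all_boot all_order all_algebra.
From mathcomp Require Import classical_sets reals.
From mathcomp Require Import complex mpoly.
From mathcomp Require Import ring lra.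

Set Implicit Arguments.
Unset Strict Implicit.
Unset Printing Implicit Defensive.

Import Order.TTheory GRing.Theory Num.Theory.
Local Open Scope ring_scope.

(** * Continuity of the zeros of complex polynomials *)

(** Connectedness of the segment, by a supremum: local constancy carries [P] to the supremum of the
    [t] such that [P] holds on [[0, t]], and past it if it is below 1. *)
Lemma locally_constant_unit_segment (R : realType) (P : R -> Prop) :
  (forall t, 0 <= t <= 1 -> exists2 d, 0 < d &
     forall s, 0 <= s <= 1 -> `|s - t| < d -> (P t <-> P s)) ->
  P 0 -> P 1.
Proof.
move=> locP P0.
pose A := [set t : R | 0 <= t <= 1 /\ forall s, 0 <= s <= t -> P s]%classic.
have A0 : A 0.
  split; first by rewrite lexx ler01.
  by move=> s /le_anti <-.
have supA : has_sup A.
  by split; [exists 0 | exists 1 => t [/andP[]]].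
have s0 : 0 <= sup A by exact: ub_le_sup supA.2 _ A0.
have s1 : sup A <= 1 by apply: ge_sup; [exists 0 | move=> t [/andP[]]].
have [d d0 dP] := locP (sup A) (introT andP (conj s0 s1)).
have [t [tI At] lt_t] := sup_adherent d0 supA.
have le_t : t <= sup A by apply: ub_le_sup supA.2 _ _.
have Ps : P (sup A).
  apply/(dP t tI); last by apply: At; case/andP: tI => -> /=.
  by rewrite ler0_norm ?subr_le0 // opprB ltrBlDr -ltrBlDl.
move: s1; rewrite le_eqVlt => /predU1P[<- //|s1].
pose u := Num.min 1 (sup A + d / 2).
have u_gt : sup A < u by rewrite lt_min s1 /=; lra.
have : A u.
  split; first by rewrite ge_min lexx andbT; lra.
  move=> r /andP[r0 ru]; have [rt|tr] := leP r t.
    by apply: At; rewrite r0.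
  move: ru; rewrite le_min => /andP[r1 rs].
  apply/(dP r) => //; first by rewrite r0.
  by rewrite ltr_norml; lra.
by move/(ub_le_sup supA.2); rewrite leNgt u_gt.
Qed.

(** The induction carries a bound on the values together with the Lipschitz constant, because the
    difference of two products involves both. Norms on [R[i]] take values in [R[i]], hence the type
    of [K]. *)
Lemma horner_lipschitz (R : realType) (q : {poly R[i]}) :
  exists2 K : R[i], 0 <= K & forall s t : R, 0 <= s <= 1 -> 0 <= t <= 1 ->
    `|q.[s%:C%C] - q.[t%:C%C]| <= K * `|s%:C%C - t%:C%C|.
Proof.
have norm_le1 (s : R) : 0 <= s <= 1 -> `|s%:C%C| <= 1.
  by case/andP=> s0 s1; rewrite ger0_norm ?ler0c // (lecR s 1).
suff [K K0 KP] : exists2 K : R[i], 0 <= K & forall s t : R,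
    0 <= s <= 1 -> 0 <= t <= 1 -> `|q.[s%:C%C]| <= K /\
    `|q.[s%:C%C] - q.[t%:C%C]| <= K * `|s%:C%C - t%:C%C|.
  by exists K => // s t sI tI; have [] := KP s t sI tI.
elim/poly_ind: q => [|q c [K K0 KP]].
  by exists 0 => // s t _ _; rewrite !horner0 subr0 mul0r normr0.
exists (K + K + `|c|) => [|s t sI tI]; first by rewrite !addr_ge0.
have [qs lst] := KP s t sI tI; rewrite !hornerMXaddC; split.
  rewrite (le_trans (ler_normD _ _)) // lerD2r normrM -[leLHS]addr0 lerD //.
  by rewrite -[leRHS]mulr1 ler_pM // norm_le1.
rewrite (_ : _ - _ = (q.[s%:C%C] - q.[t%:C%C]) * t%:C%C
                     + q.[s%:C%C] * (s%:C%C - t%:C%C)); last by ring.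
rewrite (le_trans (ler_normD _ _)) // !normrM !mulrDl -[leLHS]addr0.
rewrite lerD ?mulr_ge0 // lerD ?ler_wpM2r //.
by rewrite (le_trans _ lst) // -[leRHS]mulr1 ler_pM // norm_le1.
Qed.

(** The outer variable of [F] is [w], the inner one the deformation parameter. [K] is uniform in
    [w]: the growth in [w] goes into [(1 + |w|) ^+ n], which dominates every [|w| ^+ i] with
    [i <= n]. *)
Lemma horner2_lipschitz (R : realType) (n : nat) (F : {poly {poly R[i]}}) :
  (size F <= n.+1)%N ->
  exists2 K : R[i], 0 < K & forall (s t : R) (w : R[i]),
    0 <= s <= 1 -> 0 <= t <= 1 ->
    `|F.[w%:P].[s%:C%C] - F.[w%:P].[t%:C%C]|
      <= K * `|s%:C%C - t%:C%C| * (1 + `|w|) ^+ n.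
Proof.
move=> sF.
have /fin_all_exists2[K K0 KP] i := horner_lipschitz F`_(i : 'I_n.+1).
exists (1 + \sum_i K i) => [|s t w sI tI]; first by rewrite ltr_wpDr ?sumr_ge0.
rewrite !(horner_coef_wide _ sF) !horner_sum -sumrB.
rewrite (le_trans (ler_norm_sum _ _ _)) // !mulrDl !mulr_suml.
rewrite -[leLHS]add0r lerD //.
  by rewrite mul1r mulr_ge0 // exprn_ge0 // addr_ge0.
apply: ler_sum => i _.
rewrite !hornerM -!polyC_exp !hornerC -mulrBl normrM ler_pM ?KP // normrX.
have w1 : `|w| <= 1 + `|w| by rewrite lerDr.
rewrite (le_trans (lerXn2r _ _ _ w1)) ?nnegrE ?addr_ge0 //.
by rewrite ler_weXn2l ?lerDl // -ltnS.
Qed.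
Lemma normc_ge_Im (R : rcfType) (z : R[i]) : `|complex.Im z|%:C%C <= `|z|.
Proof.
have := normc_ge_Re (z * 'i%C); rewrite ReiNIm normrN normrM.
by rewrite [`|'i%C|]normc_def /= expr0n expr1n add0r sqrtr1 mulr1.
Qed.

Lemma ImB (R : rcfType) (w z : R[i]) :
  complex.Im (w - z) = complex.Im w - complex.Im z.
Proof. by case: w; case: z. Qed.

Lemma size_polyE (R : nzRingType) (n : nat) (q : {poly R}) :
  (size q <= n.+1)%N -> q`_n != 0 -> size q = n.+1 /\ lead_coef q = q`_n.
Proof.
move=> sq qn; have sqE : size q = n.+1.
  by apply/eqP; rewrite eqn_leq sq ltnNge; apply: contra qn => /leq_sizeP->.
by rewrite lead_coefE sqE.
Qed.

Lemma closed_poly_factor (K : closedFieldType) (n : nat) (q : {poly K}) :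
  (size q <= n.+1)%N -> q`_n != 0 ->
  exists r : n.-tuple K, q = q`_n *: \prod_(i < n) ('X - (tnth r i)%:P).
Proof.
move=> sq qn; have [sqE lq] := size_polyE sq qn.
have [r qE] := closed_field_poly_normal q; rewrite lq in qE.
have sr : size r == n.
  by rewrite -eqSS -sqE qE size_scale // size_prod_XsubC.
exists (Tuple sr); rewrite {1}qE; congr (_ *: _).
exact: (big_tuple _ _ (Tuple sr) xpredT (fun z => 'X - z%:P)).
Qed.

(* The zeros of a polynomial depend continuously on its coefficients, so none
   can enter the closed upper half plane without meeting the real line. *)
Lemma lower_half_plane_homotopy (R : realType) (n : nat) (c : R[i])
    (F : {poly {poly R[i]}}) :
  (size F <= n.+1)%N -> F`_n = c%:P -> c != 0 ->
  (forall s x : R, 0 <= s <= 1 -> F.[x%:C%C%:P].[s%:C%C] != 0) ->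
  (forall w, F.[w%:P].[0] = 0 -> complex.Im w < 0) ->
  forall w, F.[w%:P].[1] = 0 -> complex.Im w < 0.
Proof.
move=> sF Fn c0 F_real F_0.
pose P (s : R) := forall w, F.[w%:P].[s%:C%C] = 0 -> complex.Im w < 0.
(* The coefficient of degree [n] in [w] is the constant [c != 0], so no zero escapes to infinity as
   [s] varies. *)
have factorF (s : R) : exists r : n.-tuple R[i], forall w,
    F.[w%:P].[s%:C%C] = c * \prod_(i < n) (w - tnth r i).
  pose q := map_poly (horner_eval s%:C%C) F.
  have qn : q`_n = c by rewrite coef_map Fn /= /horner_eval hornerC.
  have sq : (size q <= n.+1)%N by rewrite (leq_trans (size_poly _ _)).
  have [|r qE] := closed_poly_factor sq; first by rewrite qn.
  exists r => w; have -> : F.[w%:P].[s%:C%C] = q.[w].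
    by rewrite -[w in RHS](hornerC w s%:C%C) horner_map.
  rewrite qE hornerZ qn horner_prod.
  by congr (_ * _); apply: eq_bigr => i _; rewrite !hornerE.
have [K K0 KP] := horner2_lipschitz sF.
have rootN (r : n.-tuple R[i]) (s : R) : P s ->
    (forall w, F.[w%:P].[s%:C%C] = c * \prod_(i < n) (w - tnth r i)) ->
    forall i, complex.Im (tnth r i) < 0.
  move=> Ps rE i; apply: Ps; rewrite rE (bigD1 i) //= subrr mul0r mulr0 //.
suff : P 1 by move=> P1 w w1; apply: P1; rewrite rmorph1.
apply: (@locally_constant_unit_segment R P) => [t tI|]; last first.
  by move=> w; rewrite rmorph0; exact: F_0.
have [r rE] := factorF t.
suff [d d0 dP] : exists2 d : R[i], 0 < d & forall s : R, 0 <= s <= 1 ->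
    `|s%:C%C - t%:C%C| < d -> (P t <-> P s).
  exists (complex.Re d); first by move: d0; rewrite ltcE => /andP[].
  move=> s sI lt_st; apply: dP => //.
  rewrite -rmorphB; set u := s - t in lt_st *.
  have -> : `|u%:C%C| = `|u|%:C%C.
    by rewrite normc_def /= expr0n addr0 sqrtr_sqr.
  have /eqP Id0 : complex.Im d == 0 by rewrite (ger0_Im (ltW d0)).
  by rewrite ltcE /= Id0 eqxx.
have [Pt|NPt] := boolp.pselect (P t).
  have rN := rootN _ _ Pt rE.
  (* If Im w >= 0, then |w - r_i| >= - Im r_i, so 1 + |w| <= |w - r_i| (1 + (1 + |r_i|) / (- Im
     r_i)). With the product [L] of these constants, the Lipschitz bound at a zero [w] for the
     parameter [s] becomes |c| <= K L |s - t|. *)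
  pose L := \prod_(i < n)
    (1 + (1 + `|tnth r i|) / (- complex.Im (tnth r i))%:C%C).
  have IN i : 0 < (- complex.Im (tnth r i))%:C%C by rewrite (ltcR 0) oppr_gt0.
  have L0 : 0 < L.
    apply: prodr_gt0 => i _; rewrite ltr_wpDr // divr_ge0 // ?addr_ge0 //.
    exact: ltW.
  exists (`|c| / (K * L)); first by rewrite divr_gt0 ?mulr_gt0 ?normr_gt0.
  move=> s sI; rewrite ltr_pdivlMr ?mulr_gt0 // => lt_st.
  split=> // _ w ws; rewrite ltNge; apply/negP => w_ge0.
  have dist i : (- complex.Im (tnth r i))%:C%C <= `|w - tnth r i|.
    rewrite (le_trans _ (normc_ge_Im _)) // lecR ImB.
    by rewrite (le_trans _ (ler_norm _)) // -[leLHS]add0r lerD2r.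
  have dist0 i : 0 < `|w - tnth r i| by apply: lt_le_trans (dist i).
  have := KP t s w tI sI; rewrite ws subr0 rE normrM normr_prod.
  set Q := \prod_i _; have Q0 : 0 < Q by apply: prodr_gt0.
  have wQ : (1 + `|w|) ^+ n <= L * Q.
    rewrite -[n in _ ^+ n]card_ord -prodr_const -big_split /=.
    apply: ler_prod => i _; rewrite addr_ge0 //= mulrDl mul1r.
    have := ler_normD (w - tnth r i) (tnth r i); rewrite subrK => tri.
    rewrite (le_trans (lerD (lexx 1) tri)) // addrCA lerD2l.
    by rewrite mulrAC ler_pdivlMr // ler_wpM2l // addr_ge0.
  have st0 : 0 <= K * `|t%:C%C - s%:C%C| by rewrite mulr_ge0 // ltW.
  move/le_trans => /(_ _ (ler_wpM2l st0 wQ)).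
  rewrite mulrA ler_pM2r // distrC mulrAC mulrC => /(lt_le_trans lt_st).
  by rewrite ltxx.
have {NPt}[z [zt z0]] : exists z, F.[z%:P].[t%:C%C] = 0 /\ 0 < complex.Im z.
  apply: boolp.contrapT => /boolp.forallNP NE; apply: NPt => z zt.
  have [// | z0 |z0] := ltgtP (complex.Im z) 0; first by have [] := NE z.
  have := F_real t (complex.Re z) tI.
  suff -> : (complex.Re z)%:C%C = z by rewrite zt eqxx.
  by case: z z0 {zt} => a b /= ->.
have z0C : 0 < (complex.Im z)%:C%C by rewrite (ltcR 0).
have zn0 : 0 < (1 + `|z|) ^+ n by rewrite exprn_gt0 // ltr_wpDr.
(* Under [P s] all zeros for the parameter [s] are at distance at least Im z from [z], so the value
   at [z] has norm at least |c| (Im z)^n. Within this radius the Lipschitz bound forbids that. *)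
exists (`|c| * (complex.Im z)%:C%C ^+ n / (K * (1 + `|z|) ^+ n)).
  by rewrite divr_gt0 ?mulr_gt0 ?normr_gt0 // exprn_gt0.
move=> s sI; rewrite ltr_pdivlMr ?mulr_gt0 // => lt_st.
split=> [Pt|Ps]; first by have := Pt z zt; rewrite ltNge (ltW z0).
have [r' r'E] := factorF s; have r'N := rootN _ _ Ps r'E.
have := KP s t z sI tI; rewrite zt subr0 r'E normrM normr_prod.
rewrite -mulrA mulrCA => /le_lt_trans/(_ lt_st).
rewrite ltr_pM2l ?normr_gt0 // => /lt_geF/negbT/negP[].
rewrite -[n in _ ^+ n]card_ord -prodr_const.
apply: ler_prod => i _; rewrite ltW //=.
rewrite (le_trans _ (normc_ge_Im _)) // lecR ImB.
by rewrite (le_trans _ (ler_norm _)) // lerDl oppr_ge0 ltW.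
Qed.
(** * Evaluation of homogeneous polynomials *)

Section MmapMorphism.
Variables (d n : nat) (R : nzRingType) (S T : comNzRingType).
Implicit Types (f : R -> S) (v : 'I_d -> S) (p : {mpoly R[d]}).

Lemma eq_mmap f v w p : v =1 w -> mmap f v p = mmap f w p.
Proof.
move=> vw; apply: eq_bigr => m _; congr (_ * _).
by apply: eq_bigr => i _; rewrite vw.
Qed.

Lemma rmorph_mmap (g : {rmorphism S -> T}) f v p :
  g (mmap f v p) = mmap (g \o f) (g \o v) p.
Proof.
rewrite /mmap rmorph_sum; apply: eq_bigr => m _.
rewrite rmorphM rmorph_prod; congr (_ * _).
by apply: eq_bigr => i _; rewrite rmorphXn.
Qed.

Lemma mmap_homogZ f (c : S) v p : p \is n.-homog ->
  mmap f (fun i => c * v i) p = c ^+ n * mmap f v p.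
Proof.
move=> hp; rewrite /mmap big_distrr; apply: eq_big_seq => m mp /=.
have /= <- := dhomog_mf hp mp; rewrite mulrCA; congr (_ * _).
rewrite mdegE expr_sum -big_split /=.
by apply: eq_bigr => i _; rewrite exprMn.
Qed.

(** Restriction of [p] to an affine line. The coefficient of degree [n] sees only the direction [a].
    The ring [S] is general so that the base point [b] may itself be a polynomial in the deformation
    parameter. *)
Lemma mmap_homog_affine f (a b : 'I_d -> S) p : p \is n.-homog ->
  let q := mmap (polyC \o f) (fun i => a i *: 'X + (b i)%:P) p in
  (size q <= n.+1)%N /\ q`_n = mmap f a p.
Proof.
move=> hp /=; pose deg (q : {poly S}) k c := (size q <= k.+1)%N /\ q`_k = c.
have degM q r j k s t : deg q j s -> deg r k t -> deg (q * r) (j + k)%N (s * t).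
  move=> [sq <-] [sr <-]; split.
    rewrite (leq_trans (size_polyMleq _ _)) // -subn1 leq_subLR add1n.
    by rewrite (leq_trans (leq_add sq sr)) // addSn addnS.
  have lt_j : (j < (j + k).+1)%N by rewrite ltnS leq_addr.
  rewrite coefM (bigD1 (Ordinal lt_j)) //= addKn big1 ?addr0 // => i.
  rewrite -val_eqE /= => ne_ij; case: (ltngtP i j) ne_ij => // [lt_ij|lt_ji] _.
    rewrite [r`__]nth_default ?mulr0 // (leq_trans sr) //.
    by rewrite ltn_subRL ltn_add2r.
  by rewrite [q`__]nth_default ?mul0r // (leq_trans sq).
have degC c : deg c%:P 0%N c by rewrite /deg size_polyC leq_b1 coefC.
have deg_affine i : deg (a i *: 'X + (b i)%:P) 1%N (a i).
  split; last by rewrite coefD coefZ coefX coefC mulr1 addr0.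
  rewrite (leq_trans (size_polyD _ _)) // geq_max.
  rewrite (leq_trans (size_scale_leq _ _)) ?size_polyX //=.
  by rewrite size_polyC (leq_trans (leq_b1 _)).
have degX q c k l : deg q k c -> deg (q ^+ l) (l * k)%N (c ^+ l).
  move=> hq; elim: l => [|l IH]; first exact: (degC).
  by rewrite !exprS mulSn; apply: (degM).
have deg_m m : m \in msupp p ->
    deg ((f p@_m)%:P * mmap1 (fun i => a i *: 'X + (b i)%:P) m) n
        (f p@_m * mmap1 a m).
  move=> mp; rewrite -[n]add0n; apply: (degM) => //.
  have /= <- := dhomog_mf hp mp; rewrite mdegE.
  apply: (big_rec3 (fun q c k => deg q k c)) => [|i q c k _].
    exact: (degC).
  by apply: (degM); have := degX _ _ _ (m i) (deg_affine i); rewrite muln1.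
split; last first.
  rewrite coef_sum /mmap; apply: eq_big_seq => m /deg_m[_ <-] //.
rewrite (leq_trans (size_sum _ _ _)) //.
by apply/bigmax_leqP_seq => m /deg_m[].
Qed.

End MmapMorphism.

Section EvalC.
Variables (R : realType) (d n : nat) (p : {mpoly R[d]}).
Hypothesis hp : p \is n.-homog.
Implicit Types v : 'I_d -> R[i].

Definition evalC v : R[i] := mmap (real_complex R) v p.

Lemma eq_evalC v v' : v =1 v' -> evalC v = evalC v'.
Proof. exact: eq_mmap. Qed.

Lemma evalCZ c v : evalC (fun i => c * v i) = c ^+ n * evalC v.
Proof. exact: mmap_homogZ. Qed.

(** Here [F] is p (w a + s v + u) as a polynomial in w over polynomials in s; its leading
    coefficient p(a) is independent of s, and s = 0 removes [v]. *)
Lemma evalC_homotopy (a u v : 'I_d -> R[i]) :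
  evalC a != 0 ->
  (forall s x : R, 0 <= s <= 1 ->
     evalC (fun i => a i * x%:C%C + (v i * s%:C%C + u i)) != 0) ->
  (forall w : R[i], evalC (fun i => a i * w + u i) = 0 -> complex.Im w < 0) ->
  forall w : R[i], evalC (fun i => a i * w + (v i + u i)) = 0 ->
  complex.Im w < 0.
Proof.
move=> a0 no_real roots0.
pose F := mmap (polyC \o (polyC \o real_complex R))
  (fun i => (a i)%:P *: 'X + (v i *: 'X + (u i)%:P)%:P) p.
have FE (w t : R[i]) :
    F.[w%:P].[t] = evalC (fun i => a i * w + (v i * t + u i)).
  pose g : {rmorphism {poly {poly R[i]}} -> R[i]} :=
    [the {rmorphism _ -> _} of horner_eval t \o horner_eval w%:P].
  have -> : F.[w%:P].[t] = g F by [].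
  rewrite rmorph_mmap.
  have -> : g \o (polyC \o (polyC \o real_complex R)) = real_complex R.
    by apply/boolp.funext => r; rewrite /= /horner_eval !hornerC.
  by apply: eq_mmap => i; rewrite /= /horner_eval !hornerE.
have [sF Fn] := mmap_homog_affine (polyC \o real_complex R)
  (fun i => (a i)%:P) (fun i => v i *: 'X + (u i)%:P) hp.
have {}Fn : F`_n = (evalC a)%:P by rewrite Fn rmorph_mmap.
move=> w w0; apply: (lower_half_plane_homotopy sF Fn a0) => [s x sI|z|].
- by rewrite FE no_real.
- rewrite FE => z0; apply: roots0; rewrite -z0.
  by apply: eq_evalC => i; rewrite mulr0 add0r.
- by rewrite FE -[RHS]w0; apply: eq_evalC => i; rewrite mulr1.
Qed.

End EvalC.

Lemma poly_eq_horner (R : numDomainType) (q r : {poly R}) :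
  (forall t, q.[t] = r.[t]) -> q = r.
Proof.
move=> qr; apply/eqP; rewrite -subr_eq0; apply/eqP.
apply: (@roots_geq_poly_eq0 _ _ [seq i%:R | i <- iota 0 (size (q - r))]).
- by apply/allP => _ /mapP[i _ ->]; rewrite rootE hornerD hornerN qr subrr.
- rewrite map_inj_uniq ?iota_uniq // => i j /eqP; rewrite eqr_nat => /eqP //.
- by rewrite size_map size_iota.
Qed.

(** * The hyperbolicity cone and the trace *)

Section HyperbolicCone.
Variables (R : realType) (V : vectType R) (n : nat) (S : hyperbolic_system V n).
Local Notation p := (hpoly S).
Local Notation e := (hdir S).
Local Notation eig := (eigseq S).
Implicit Types (x y a b : V) (t : R) (z w : R[i]).

Definition cvec x (i : 'I_(\dim {:V})) : R[i] :=
  (coord (vbasis {:V}) i x)%:C%C.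

Lemma cvecD x y i : cvec (x + y) i = cvec x i + cvec y i.
Proof. by rewrite /cvec linearD rmorphD. Qed.

Lemma cvecZ t x i : cvec (t *: x) i = t%:C%C * cvec x i.
Proof. by rewrite /cvec linearZ rmorphM. Qed.

Lemma evalC_cvec x : evalC p (cvec x) = (evalV p x)%:C%C.
Proof. by rewrite /evalV /meval (rmorph_mmap (real_complex R)). Qed.

Lemma evalVZ t x : evalV p (t *: x) = t ^+ n * evalV p x.
Proof.
rewrite -(mmap_homogZ idfun t _ (hpoly_homog S)).
by apply: eq_mmap => i; rewrite linearZ.
Qed.

Lemma evalV_eigseq t x :
  evalV p (t *: e - x) = evalV p e * \prod_(l <- eig x) (t - l).
Proof.
rewrite -horner_charpolyV eigseqP hornerZ horner_prod.
by congr (_ * _); apply: eq_bigr => l _; rewrite !hornerE.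
Qed.

Lemma mem_eigseq x t : (t \in eig x) = (evalV p (t *: e - x) == 0).
Proof.
rewrite evalV_eigseq mulf_eq0 (negPf (hpoly_dir_neq0 S)) /= prodf_seq_eq0.
apply/idP/hasP => [tx | [l lx /=]]; first by exists t; rewrite //= subrr.
by rewrite subr_eq0 => /eqP->.
Qed.

(** For [w != 0], homogeneity pulls out the factor [- w] and leaves the characteristic polynomial at
    [- z / w]. The powers match because [x] has exactly [n] eigenvalues. *)
Lemma evalC_eigseq z w x :
  evalC p (fun i => z * cvec e i + w * cvec x i)
  = (evalV p e)%:C%C * \prod_(l <- eig x) (z + w * l%:C%C).
Proof.
have charpolyC u : evalC p (fun i => u * cvec e i - cvec x i)
    = (evalV p e)%:C%C * \prod_(l <- eig x) (u - l%:C%C).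
  pose g : {rmorphism {poly R} -> R[i]} :=
    [the {rmorphism _ -> _} of horner_eval u \o map_poly (real_complex R)].
  transitivity (g (charpolyV p e x)).
    rewrite rmorph_mmap; have -> : g \o (@polyC R) = real_complex R.
      by apply/boolp.funext => r; rewrite /= map_polyC /horner_eval hornerC.
    apply: eq_mmap => i; rewrite /= /horner_eval rmorphB /= map_polyC /=.
    by rewrite map_polyZ map_polyX !hornerE mulrC.
  rewrite eigseqP /= /horner_eval map_polyZ hornerZ rmorph_prod horner_prod.
  congr (_ * _); apply: eq_bigr => l _.
  by rewrite rmorphB /= map_polyX map_polyC !hornerE.
have prod_const u : \prod_(l <- eig x) u = u ^+ n.
  by rewrite (big_nth 0) big_mkord prodr_const card_ord size_eigseq.
have [->|w0] := eqVneq w 0.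
  rewrite (eq_evalC _ (v' := fun i => z * cvec e i)); last first.
    by move=> i; rewrite mul0r addr0.
  rewrite (evalCZ (hpoly_homog S)) mulrC evalC_cvec.
  congr (_ * _); under eq_bigr do rewrite mul0r addr0.
  by rewrite prod_const.
rewrite (eq_evalC _ (v' := fun i => - w * (- z / w * cvec e i - cvec x i))).
  rewrite (evalCZ (hpoly_homog S)) charpolyC mulrCA; congr (_ * _).
  rewrite -prod_const -big_split /=.
  by apply: eq_bigr => l _; field.
by move=> i; field.
Qed.

(** * Convexity of the hyperbolicity cone *)

Definition hcone_int x := forall l, l \in eig x -> 0 < l.

Lemma evalC_hcone_int_neq0 a : hcone_int a -> evalC p (cvec a) != 0.
Proof.
move=> a_int; rewrite (eq_evalC _ (v' := fun i => 0 * cvec e i + 1 * cvec a i)).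
  rewrite evalC_eigseq mulf_neq0 //.
    by rewrite (inj_eq (@complexI R) _ 0) hpoly_dir_neq0.
  rewrite prodf_seq_neq0; apply/allP => l /a_int l0 /=.
  by rewrite add0r mul1r (inj_eq (@complexI R) _ 0) gt_eqF.
by move=> i; rewrite mul0r mul1r add0r.
Qed.

(** A vanishing factor gives z = - w l with l > 0, so Im w and Im z have opposite signs. *)
Lemma evalC_eq0_Im_lt0 z w a : hcone_int a -> 0 < complex.Im z ->
  evalC p (fun i => z * cvec e i + w * cvec a i) = 0 -> complex.Im w < 0.
Proof.
move=> a_int z0 /eqP; rewrite evalC_eigseq mulf_eq0.
rewrite (inj_eq (@complexI R) _ 0) (negPf (hpoly_dir_neq0 S)) prodf_seq_eq0 /=.
case/hasP=> l /a_int l0 /eqP; case: z z0 => zr zi /= zi0; case: w => wr wi [].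
move=> _; rewrite mulr0 add0r => h; rewrite ltNge; apply/negP => /= wi0.
by have := mulr_ge0 wi0 (ltW l0); lra.
Qed.

(* Letting [z] tend to [0], [a] is itself a direction of hyperbolicity. *)
Lemma evalC_hcone_int_real z w a x : hcone_int a -> 0 < complex.Im z ->
  evalC p (fun i => cvec a i * w + (cvec x i + z * cvec e i)) = 0 ->
  complex.Im w < 0.
Proof.
move=> a_int z0; apply: (evalC_homotopy (hpoly_homog S)).
- exact: evalC_hcone_int_neq0.
(* At a real [w = r] the point is z e + y with [y] real, and the factors z + l with l real cannot
   vanish. *)
- move=> s r _; apply/eqP => h; pose y : V := r *: a + s *: x.
  have : evalC p (fun i => z * cvec e i + 1 * cvec y i) = 0.
    by rewrite -[RHS]h; apply: eq_evalC => i; rewrite cvecD !cvecZ; ring.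
  move/eqP; rewrite evalC_eigseq mulf_eq0.
  rewrite (inj_eq (@complexI R) _ 0) (negPf (hpoly_dir_neq0 S)) /=.
  rewrite prodf_seq_eq0; case/hasP=> l _ /eqP; rewrite mul1r.
  case: z z0 {h} => zr zi /= zi0 [_].
  by rewrite addr0 => zi_eq0; rewrite zi_eq0 ltxx in zi0.
- move=> v h; apply: (evalC_eq0_Im_lt0 (z := z) a_int) => //.
  by rewrite -[RHS]h; apply: eq_evalC => i; ring.
Qed.

(** The deformation shrinks [w a] to 0. A zero at a real [u = r] would be a zero of p at (w s) a + r
    b + z e with Im (w s) >= 0, which [evalC_hcone_int_real] excludes, with [r b] as the real
    vector. *)
Lemma evalC_hcone_int_pair z w u a b : hcone_int a -> hcone_int b ->
  0 < complex.Im z -> 0 < complex.Im w ->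
  evalC p (fun i => cvec b i * u + (w * cvec a i + z * cvec e i)) = 0 ->
  complex.Im u < 0.
Proof.
move=> a_int b_int z0 w0; apply: (evalC_homotopy (hpoly_homog S)).
- exact: evalC_hcone_int_neq0.
- move=> s r /andP[s0 _]; apply/eqP => h.
  have := @evalC_hcone_int_real z (w * s%:C%C) a (r *: b) a_int z0.
  rewrite (_ : complex.Im _ = complex.Im w * s); last first.
    by case: w {w0 h} => wr wi; rewrite /= mulr0 add0r.
  rewrite ltNge mulr_ge0 ?(ltW w0) //= => /(_ _)/notF; apply.
  by rewrite -[RHS]h; apply: eq_evalC => i; rewrite cvecZ; ring.
- move=> v h; apply: (evalC_eq0_Im_lt0 (z := z) b_int) => //.
  by rewrite -[RHS]h; apply: eq_evalC => i; ring.
Qed.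

Lemma hconeP x : hcone S x <-> {in eig x, forall l, 0 <= l}.
Proof.
split=> [hx l /(nthP 0)[k] | hx i]; last first.
  by rewrite mxE hx // mem_nth // size_eigseq.
by rewrite size_eigseq => lt_k <-; have := hx (Ordinal lt_k); rewrite mxE.
Qed.

Lemma mem_eigseqDZ x s t : (t \in eig (x + s *: e)) = (t - s \in eig x).
Proof. by rewrite !mem_eigseq scalerBl opprD addrA addrAC -addrA addrC. Qed.

Lemma mem_eigseqZ s x t : s != 0 -> (t \in eig (s *: x)) = (t / s \in eig x).
Proof.
move=> s0; rewrite !mem_eigseq.
have -> : t *: e - s *: x = s *: ((t / s) *: e - x).
  by rewrite scalerBr scalerA mulrC divfK.
by rewrite evalVZ mulf_eq0 expf_eq0 (negPf s0) andbF.
Qed.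

Lemma hcone_int_shift x t : hcone S x -> 0 < t -> hcone_int (x + t *: e).
Proof.
move=> /hconeP hx t0 l; rewrite mem_eigseqDZ => /hx; lra.
Qed.

Lemma hconeD x y : hcone S x -> hcone S y -> hcone S (x + y).
Proof.
move=> hx hy; apply/hconeP => l; rewrite mem_eigseq => /eqP l_eig.
(* A negative eigenvalue [l] of [x + y] is split into three equal shares: two push [x] and [y] into
   the open cone, the third is the coefficient of [e]. Then [T = x + y - l e] is a zero of p. *)
rewrite leNgt; apply/negP => l0; pose t := - l / 3.
have t0 : 0 < t by rewrite divr_gt0 // oppr_gt0.
pose a := x + t *: e; pose b := y + t *: e; pose T := b + (a + t *: e).
have T0 : evalV p T = 0.
  have -> : T = -1 *: (l *: e - (x + y)); last by rewrite evalVZ l_eig mulr0.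
  rewrite (_ : l = - (t + t + t)); last by rewrite /t; field.
  rewrite /T /a /b scaleN1r opprB scaleNr opprK !scalerDl.
  set u := t *: e; by rewrite -(addrA x) addrACA (addrC y) (addrA u).
(* By homogeneity p (i T) = i^n p(T) = 0, while the lemma with z = t i and w = u = i would give Im i
   < 0. *)
have := @evalC_hcone_int_pair (t%:C%C * 'i%C) 'i%C 'i%C a b
  (hcone_int_shift hx t0) (hcone_int_shift hy t0).
rewrite /= mul0r mulr1 addr0 t0 ltr01 => /(_ isT isT).
rewrite (eq_evalC _ (v' := fun i => 'i%C * cvec T i)); last first.
  by move=> i; rewrite !cvecD !cvecZ; ring.
rewrite (evalCZ (hpoly_homog S)) evalC_cvec T0 mulr0 => /(_ erefl).
by rewrite ltNge ler01.
Qed.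


Lemma hcone0 : hcone S 0.
Proof.
apply/hconeP => l; rewrite mem_eigseq subr0 evalVZ mulf_eq0.
by rewrite (negPf (hpoly_dir_neq0 S)) orbF expf_eq0 => /andP[_ /eqP->].
Qed.

Lemma hconeZ t x : 0 <= t -> hcone S x -> hcone S (t *: x).
Proof.
rewrite le_eqVlt => /predU1P[<- _ | t0 /hconeP hx].
  by rewrite scale0r; exact: hcone0.
apply/hconeP => l; rewrite mem_eigseqZ ?gt_eqF // => /hx.
by rewrite pmulr_lge0 ?invr_gt0.
Qed.

Lemma hcone_sum (I : finType) (F : I -> V) :
  (forall i, hcone S (F i)) -> hcone S (\sum_i F i).
Proof.
by move=> hF; elim/big_ind: _ => //; [exact: hcone0 | exact: hconeD].
Qed.

(** * Linearity of the trace *)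

Lemma htraceE x : htrace S x = \sum_(l <- eig x) l.
Proof.
rewrite (big_nth 0) big_mkord size_eigseq.
by apply: eq_bigr => i _; rewrite mxE.
Qed.

Lemma evalV_dir_sub t x :
  evalV p (e - t *: x) = evalV p e * \prod_(l <- eig x) (1 - t * l).
Proof.
apply: complexI; rewrite -evalC_cvec rmorphM rmorph_prod.
rewrite (eq_evalC _ (v' := fun i => 1 * cvec e i + (- t)%:C%C * cvec x i)).
  rewrite evalC_eigseq; congr (_ * _); apply: eq_bigr => l _.
  by rewrite rmorphB rmorph1 rmorphM rmorphN mulNr.
by move=> i; rewrite cvecD -scaleNr cvecZ mul1r.
Qed.

(* The polynomial [s |-> p (e - s x)]: its linear coefficient is linear in [x]
   and equals, up to the factor [- p e], the trace of [x]. *)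
Definition dirpoly x : {poly R} := mmap (@polyC R)
  (fun i => (coord (vbasis {:V}) i e)%:P - coord (vbasis {:V}) i x *: 'X) p.

Lemma dirpolyE x :
  dirpoly x = evalV p e *: \prod_(l <- eig x) (1 - l *: 'X).
Proof.
apply: poly_eq_horner => t; rewrite hornerZ horner_prod.
transitivity (evalV p (e - t *: x)).
  rewrite /dirpoly -/(horner_eval t _) (rmorph_mmap (horner_eval t)).
  have -> : horner_eval t \o (@polyC R) = idfun.
    by apply/boolp.funext => r; rewrite /= /horner_eval hornerC.
  apply: eq_mmap => i; rewrite /= /horner_eval !hornerE linearB linearZ /=.
  by rewrite mulrC.
rewrite evalV_dir_sub; congr (_ * _); apply: eq_bigr => l _.
by rewrite !hornerE mulrC.
Qed.

Lemma coef1_dirpoly x : (dirpoly x)`_1 = - evalV p e * htrace S x.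
Proof.
rewrite dirpolyE coefZ htraceE mulNr -mulrN; congr (_ * _).
suff [] : (\prod_(l <- eig x) (1 - l *: 'X))`_0 = 1 /\
  (\prod_(l <- eig x) (1 - l *: 'X))`_1 = - \sum_(l <- eig x) l by [].
elim: (eig x) => [|l s [IH0 IH1]]; first by rewrite !big_nil !coefC oppr0.
rewrite !big_cons !coefM !big_ord_recl !big_ord0 /= IH0 IH1.
rewrite !coefB !coefZ !coefX !coefC /=; split; first by ring.
by rewrite !(mulr0, mulr1, subr0, addr0, sub0r, mul1r) opprD addrC.
Qed.

(** The families [Q] satisfying [lin1] have, modulo X^2, a constant term independent of [x] and a
    linear coefficient that is linear in [x]. They contain the constants and the coordinates of e -
    x X and are stable under sums and products, hence contain [dirpoly]. *)
Lemma coef1_dirpoly_linear t x y :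
  (dirpoly (t *: x + y))`_1 = t * (dirpoly x)`_1 + (dirpoly y)`_1.
Proof.
pose lin1 (Q : V -> {poly R}) := (forall x y, (Q x)`_0 = (Q y)`_0) /\
  forall t x y, (Q (t *: x + y))`_1 = t * (Q x)`_1 + (Q y)`_1.
have lin1C c : lin1 (fun=> c%:P).
  by split=> // s u v; rewrite !coefC mulr0 addr0.
have lin1D Q1 Q2 : lin1 Q1 -> lin1 Q2 -> lin1 (fun x => Q1 x + Q2 x).
  move=> [c1 l1] [c2 l2]; split=> [u v|s u v].
    by rewrite !coefD (c1 u v) (c2 u v).
  by rewrite !coefD l1 l2; ring.
have lin1M Q1 Q2 : lin1 Q1 -> lin1 Q2 -> lin1 (fun x => Q1 x * Q2 x).
  move=> [c1 l1] [c2 l2]; split=> [u v|s u v].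
    by rewrite !coef0M (c1 u v) (c2 u v).
  rewrite !coefM !big_ord_recl !big_ord0 /=.
  by rewrite l1 l2 !(c1 _ 0) !(c2 _ 0); ring.
have lin1_affine i : lin1 (fun x => (coord (vbasis {:V}) i e)%:P
    - coord (vbasis {:V}) i x *: 'X).
  split=> [u v|s u v]; rewrite !coefB !coefZ !coefX !coefC /= ?mulr0 //.
  by rewrite linearP /=; ring.
suff [_ ->] : lin1 dirpoly by [].
rewrite /dirpoly /mmap; elim: (msupp p) => [|m s IH].
  have -> // : (fun x => \sum_(m <- [::]) (p@_m)%:P * mmap1
    (fun i => (coord (vbasis {:V}) i e)%:P - coord (vbasis {:V}) i x *: 'X) m)
    = fun=> 0%:P by apply/boolp.funext => u; rewrite big_nil.
under boolp.eq_fun do rewrite big_cons.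
apply: (lin1D) => //; apply: (lin1M) => //; rewrite /mmap1.
elim: (index_enum _) => [|i r IHr].
  by under boolp.eq_fun do rewrite big_nil; exact: (lin1C).
under boolp.eq_fun do rewrite big_cons.
apply: (lin1M) => //; elim: (m i) => [|k IHk]; first exact: (lin1C).
by under boolp.eq_fun do rewrite exprS; apply: (lin1M).
Qed.

Lemma htraceP t x y : htrace S (t *: x + y) = t * htrace S x + htrace S y.
Proof.
apply: (@mulfI _ (- evalV p e)); first by rewrite oppr_eq0 hpoly_dir_neq0.
by rewrite mulrDr mulrCA -!coef1_dirpoly coef1_dirpoly_linear.
Qed.

Lemma htrace0 : htrace S 0 = 0.
Proof. by have := htraceP 1 0 0; rewrite scaler0 addr0 mul1r; lra. Qed.

Lemma htraceZ t x : htrace S (t *: x) = t * htrace S x.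
Proof. by rewrite -[t *: x]addr0 htraceP htrace0 addr0. Qed.

Lemma htrace_sum (I : finType) (c : I -> R) (F : I -> V) :
  htrace S (\sum_i c i *: F i) = \sum_i c i * htrace S (F i).
Proof.
by elim/big_rec2: _ => [|i t x _ <-]; [exact: htrace0 | exact: htraceP].
Qed.

(** * Action of matrices: the direct implication, and the row and column sums in the converse *)

Lemma mem_eigseq_dir t l : l \in eig (t *: e) -> l = t.
Proof.
rewrite -[t *: e]add0r mem_eigseqDZ mem_eigseq subr0 evalVZ mulf_eq0.
by rewrite (negPf (hpoly_dir_neq0 S)) orbF expf_eq0 subr_eq0 => /andP[_ /eqP].
Qed.

Lemma htrace_dir : htrace S e = n%:R.
Proof.
rewrite htraceE big_seq (eq_bigr (fun=> 1)) => [|l]; last first.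
  by rewrite -{1}[e]scale1r => /mem_eigseq_dir.
by rewrite -big_seq big_const_seq count_predT size_eigseq iter_addr_0.
Qed.

(** The eigenvalues of the perturbed element are t + d l with l an eigenvalue of [x]; if [M] bounds
    all |l|, then |d| = t / M keeps them nonnegative for both signs of d. *)
Lemma hcone_dir_perturb t x : 0 < t -> exists2 d, 0 < d &
  hcone S (t *: e + d *: x) /\ hcone S (t *: e - d *: x).
Proof.
move=> t0; pose M := 1 + \sum_(l <- eig x) `|l|.
have eigM l : l \in eig x -> `|l| <= M.
  move=> lx; rewrite /M (big_rem l lx) /= addrCA lerDl addr_ge0 //.
  exact: sumr_ge0.
have M0 : 0 < M by rewrite ltr_pwDl // sumr_ge0.
suff cone d : `|d| = t / M -> hcone S (t *: e + d *: x).
  have d0 : 0 < t / M by rewrite divr_gt0.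
  exists (t / M) => //; split; first by apply: cone; rewrite gtr0_norm.
  by rewrite -scaleNr; apply: cone; rewrite normrN gtr0_norm.
move=> dE; have d0 : d != 0 by rewrite -normr_gt0 dE divr_gt0.
apply/hconeP => l; rewrite addrC mem_eigseqDZ mem_eigseqZ // => /eigM.
rewrite normrM normfV dE ler_pdivrMr ?divr_gt0 // mulrCA divff ?gt_eqF // mulr1.
by rewrite ler_norml; lra.
Qed.

Lemma e_doubly_stochastic_actVmx (D : 'M[R]_n) (A : 'I_n -> V) :
  doubly_stochastic D -> e_doubly_stochastic S A ->
  e_doubly_stochastic S (actVmx D A).
Proof.
move=> [D0 Drow Dcol] [hA trA sumA]; split=> [i|i|].
- by apply: hcone_sum => j; apply: hconeZ.
- by rewrite htrace_sum -(Drow i); apply: eq_bigr => j _; rewrite trA mulr1.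
- rewrite exchange_big -sumA; apply: eq_bigr => j _ /=.
  by rewrite -scaler_suml Dcol scale1r.
Qed.

(** Correct a vector [y] off the line of [e] by the multiple of [e] that cancels its trace; the
    result is nonzero because [y] is off that line. *)
Lemma traceless_vector : (0 < n)%N -> (1 < \dim {:V})%N ->
  exists2 x, x != 0 & htrace S x = 0.
Proof.
move=> n0 dimV; have /subvPn[y _ y_e] : ~~ ({:V} <= <[e]>)%VS.
  apply: contraL dimV => /dimvS le_dim.
  by rewrite -leqNgt (leq_trans le_dim) // dim_vline leq_b1.
exists (- (htrace S y / n%:R) *: e + y).
  apply: contraNneq y_e => /eqP; rewrite addrC scaleNr subr_eq0 => /eqP->.
  exact/memvZ/memv_line.
by rewrite htraceP htrace_dir mulNr divfK ?pnatr_eq0 -?lt0n // addNr.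
Qed.

Lemma doubly_stochastic_sums (D : 'M[R]_n) : (0 < n)%N -> (1 < \dim {:V})%N ->
  (forall A, e_doubly_stochastic S A -> e_doubly_stochastic S (actVmx D A)) ->
  (forall i, \sum_(j < n) D i j = 1) /\ (forall j, \sum_(i < n) D i j = 1).
Proof.
move=> n0 dimV presD; have nR0 : n%:R != 0 :> R by rewrite pnatr_eq0 -lt0n.
have [x x0 trx] := traceless_vector n0 dimV.
have nV0 : 0 < n%:R^-1 :> R by rewrite invr_gt0 ltr0n.
have [d d0 [hcone_pos hcone_neg]] := hcone_dir_perturb x nV0.
have hconeV : hcone S (n%:R^-1 *: e).
  by apply/hconeP => l /mem_eigseq_dir ->; exact: ltW.
pose c j := \sum_i D i j.
(* The weight is 1 at [j], -1 at [k] and 0 elsewhere; for [j = k] it vanishes, so [A k k] is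
   constantly [e / n]. *)
pose w (j k i : 'I_n) : R := (i == j)%:R - (i == k)%:R.
pose A j k i := n%:R^-1 *: e + (w j k i * d) *: x.
have sum_w (f : 'I_n -> R) j k : \sum_i f i * w j k i = f j - f k.
  have sum_delta l : \sum_i f i * (i == l)%:R = f l.
    rewrite (bigD1 l) //= eqxx mulr1 big1 ?addr0 // => i /negPf->.
    by rewrite mulr0.
  by under eq_bigr do rewrite mulrBr; rewrite sumrB !sum_delta.
have A_tr j k i : htrace S (A j k i) = 1.
  by rewrite htraceP htraceZ trx mulr0 addr0 htrace_dir mulVf.
have A_ds j k : e_doubly_stochastic S (A j k).
  split=> [i|//|].
    rewrite /A /w; case: eqP => _; case: eqP => _ /=.
    - by rewrite subrr mul0r scale0r addr0.
    - by rewrite subr0 mul1r.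
    - by rewrite sub0r mulN1r scaleNr.
    - by rewrite subrr mul0r scale0r addr0.
  rewrite big_split /= sumr_const card_ord -scaler_nat scalerA divff //.
  rewrite scale1r -scaler_suml -mulr_suml.
  under eq_bigr do rewrite -[w _ _ _]mul1r.
  by rewrite sum_w subrr mul0r scale0r addr0.
have sum_cA j k : \sum_m c m *: A j k m = e.
  have [_ _ <-] := presD _ (A_ds j k); rewrite exchange_big /=.
  by apply: eq_bigr => m _; rewrite -scaler_suml.
(* Take traces in [sum_cA]: every entry of [A] has trace 1 and [e] has trace [n]. *)
have sum_c : \sum_m c m = n%:R.
  pose k := Ordinal n0; rewrite -htrace_dir -(sum_cA k k) htrace_sum.
  by apply: eq_bigr => m _; rewrite A_tr mulr1.
(* Since the column sums add up to [n], the [e / n] terms already give [e], so the remainder (c j -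
   c k) d x is zero. *)
have c_eq j k : c j = c k.
  have : \sum_m c m *: A j k m = e + ((c j - c k) * d) *: x.
    under eq_bigr do rewrite scalerDr !scalerA.
    rewrite big_split /= -!scaler_suml -mulr_suml sum_c divff // scale1r.
    by under eq_bigr do rewrite mulrA; rewrite -mulr_suml sum_w.
  rewrite sum_cA -[LHS]addr0 => /addrI/esym/eqP.
  rewrite scaler_eq0 (negPf x0) orbF mulf_eq0 (gt_eqF d0) orbF.
  by rewrite subr_eq0 => /eqP.
split=> [i|j].
  have [_ /(_ i) + _] := presD _ (A_ds i i); rewrite htrace_sum => <-.
  by apply: eq_bigr => m _; rewrite A_tr mulr1.
apply: (mulfI nR0); rewrite mulr1 -[RHS]sum_c.
under [RHS]eq_bigr do rewrite (c_eq _ j).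
by rewrite sumr_const card_ord mulr_natl.
Qed.

(** * Jordan frames *)

Lemma jordan_frame_eigseq (c : 'I_n -> V) k : jordan_frame S c -> (1 < n)%N ->
  (0 \in eig (c k)) && (1 \in eig (c k)).
Proof.
move=> [cE _] n1.
have nth_c (i : 'I_n) : nth 0 (eig (c k)) i = (val i == 0%N)%:R.
  by have := congr1 (fun M : 'cV_n => M i 0) (cE k); rewrite !mxE.
apply/andP; split.
  (* [Ordinal n1] is the index 1, where the eigenvalue is 0; [Ordinal (ltnW n1)] below is the index
     0. *)
  by rewrite -[0](nth_c (Ordinal n1)) mem_nth // size_eigseq.
by rewrite -[1](nth_c (Ordinal (ltnW n1))) mem_nth // size_eigseq ltnW.
Qed.

(** In dimension one each frame element would be a multiple of [e], with a single eigenvalue,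
    whereas it has both 0 and 1. *)
Lemma jordan_frame_dim (c : 'I_n -> V) : jordan_frame S c -> (1 < n)%N ->
  (1 < \dim {:V})%N.
Proof.
move=> cJ n1; rewrite ltnNge; apply/negP => dimV.
have eV : <[e]>%VS = fullv.
  by apply/eqP; rewrite eqEdim subvf dim_vline hdir_neq0.
pose k := Ordinal n1; have /vlineP[t ct] : c k \in <[e]>%VS by rewrite eV memvf.
have := jordan_frame_eigseq k cJ n1; rewrite ct.
case/andP=> /mem_eigseq_dir <- /mem_eigseq_dir /eqP.
by rewrite oner_eq0.
Qed.

Lemma jordan_frame_doubly_stochastic (c : 'I_n -> V) :
  jordan_frame S c -> (0 < n)%N -> e_doubly_stochastic S c.
Proof.
move=> [cE sum_c] n0; split=> // i.
  by move=> j; rewrite cE mxE ler0n.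
rewrite /htrace cE (bigD1 (Ordinal n0)) //= mxE eqxx big1 ?addr0 // => j.
by rewrite -val_eqE mxE => /negPf->.
Qed.

(* If [b = sum_j t_j c_j] is in the cone and [M] is large, adding
   [(M - t_j) c_j] for [j != k] shows that so is [M e - (M - t_k) c_k], of
   which [t_k] is an eigenvalue. *)
Lemma jordan_frame_coef_ge0 (c : 'I_n -> V) (t : 'I_n -> R) k : (1 < n)%N ->
  jordan_frame S c -> hcone S (\sum_j t j *: c j) -> 0 <= t k.
Proof.
move=> n1 cJ hb; rewrite leNgt; apply/negP => tk0.
have [hc _ sum_c] := jordan_frame_doubly_stochastic cJ (ltnW n1).
have [_ c1] := andP (jordan_frame_eigseq k cJ n1).
(* [M] exceeds every [t j], so the added coefficients [M - t j] are nonnegative. *)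
pose M := 1 + \sum_j `|t j|.
have tM j : t j < M.
  rewrite /M (bigD1 j) //= ltr_pwDl // (le_trans (ler_norm _)) // lerDl.
  exact: sumr_ge0.
have M0 : 0 < M by rewrite ltr_pwDl // sumr_ge0.
have : hcone S ((t k - M) *: c k + M *: e).
  have -> : (t k - M) *: c k + M *: e = \sum_j t j *: c j
      + \sum_j (if j == k then 0 else M - t j) *: c j.
    rewrite -sum_c scaler_sumr [in LHS](bigD1 k) //=.
    rewrite [in X in _ = X + _](bigD1 k) //= [in X in _ = _ + X](bigD1 k) //=.
    rewrite eqxx scale0r add0r addrA -scalerDl subrK.
    rewrite -addrA -big_split /=; congr (_ + _); apply: eq_bigr => j /negPf->.
    by rewrite -scalerDl addrC subrK.
  apply: hconeD => //; apply: hcone_sum => j; apply: hconeZ => //.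
  by case: ifP => // _; rewrite subr_ge0 ltW.
have tkM : t k - M != 0 by rewrite lt_eqF // subr_lt0.
(* The eigenvalue 1 of [c k] becomes (t k - M) + M = t k. *)
move/hconeP/(_ (t k)).
rewrite mem_eigseqDZ mem_eigseqZ // divff //.
by move/(_ c1); rewrite leNgt tk0.
Qed.

End HyperbolicCone.

Theorem theorem4p2 (R : realType) (V : vectType R) (n : nat)
    (S : hyperbolic_system V n) (D : 'M[R]_n) (n_gt1 : (1 < n)%N) :
  (* (1) *)
  (doubly_stochastic D ->
     forall A : 'I_n -> V, e_doubly_stochastic S A ->
       e_doubly_stochastic S (actVmx D A))
  (* (2) *)
  /\ ((1 < \dim {:V})%N -> nonneg_mx D ->
      (forall A : 'I_n -> V, e_doubly_stochastic S A ->
         e_doubly_stochastic S (actVmx D A)) ->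
      doubly_stochastic D)
  (* (3) *)
  /\ ((exists c : 'I_n -> V, jordan_frame S c) ->
      (forall A : 'I_n -> V, e_doubly_stochastic S A ->
         e_doubly_stochastic S (actVmx D A)) ->
      doubly_stochastic D).
Proof.
have n_gt0 := ltnW n_gt1.
split; [|split] => [D_ds A|dimV D0 presD|[c cJ] presD].
- exact: e_doubly_stochastic_actVmx.
- by have [Drow Dcol] := doubly_stochastic_sums n_gt0 dimV presD.
- have [Drow Dcol] :=
    doubly_stochastic_sums n_gt0 (jordan_frame_dim cJ n_gt1) presD.
  (* The frame is itself [e]-doubly stochastic, so the combination of the frame with coefficients
     from row [i] of [D] lies in the cone. *)
  split=> // i k; have := jordan_frame_doubly_stochastic cJ n_gt0.
  case/presD=> /(_ i) cone_i _ _.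
  exact: (@jordan_frame_coef_ge0 _ _ _ S c (D i) k n_gt1 cJ cone_i).
Qed.
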